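(* Let $G$ be either a cyclic subgroup or a one-parameter continuous subgroup of the affine group $\mathcal G$, and let $G\ni g\mapsto U_g$ be a unitary representation of $G$ in a Hilbert space $\mathcal H$ (strongly continuous if $G$ is a continuous group). Assume that $\dot A$ is a closed densely defined symmetric operator in $\mathcal H$ with finite deficiency indices which is $G$-invariant with respect to this representation. Then $\dot A$ admits a $G$-invariant maximal dissipative extension.
   Context: $\mathcal G$ is the group (under composition) of affine maps $g(x)=ax+b$ of $\mathbb R$ with $a>0$, $b\in\mathbb R$; for an operator $A$, $g(A)=aA+bI$. A densely defined closed operator $A$ is $G$-invariant (with respect to $g\mapsto U_g$) if $U_g(\mathrm{Dom}(A))=\mathrm{Dom}(A)$ and $U_gAU_g^*f=aAf+bf$ for all $f\in\mathrm{Dom}(A)$ and all $g\in G$. An operator is maximal dissipative if $\operatorname{Im}(Af,f)\ge0$ on its domain and it has no proper dissipative extension. *)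

(* Defs.v *)
(* R : realType (the real numbers), C := R[i] (complex numbers
   from mathcomp-real-closed).  Complex Hilbert spaces, unbounded operators,
   the affine group and its unitary representations are set up by hand below. *)
From mathcomp Require Import all_boot all_algebra.
From mathcomp Require Import reals.
From mathcomp Require Import complex.
Import GRing.Theory Num.Theory ComplexField.
Set Implicit Arguments. Unset Strict Implicit. Unset Printing Implicit Defensive.
Local Open Scope ring_scope.
Local Open Scope complex_scope.

Section Hilbert.
Variables (R : realType) (H : lmodType R[i]) (ip : H -> H -> R[i]).

(* norm induced by the inner product *)
Definition hnorm (f : H) : R := Num.sqrt (complex.Re (ip f f)).

Definition hconverges (u : nat -> H) (l : H) : Prop :=
  forall e : R, 0 < e -> exists N : nat, forall n : nat, (N <= n)%N ->
    hnorm (u n - l) < e.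

Definition hcauchy (u : nat -> H) : Prop :=
  forall e : R, 0 < e -> exists N : nat, forall m n : nat, (N <= m)%N -> (N <= n)%N ->
    hnorm (u m - u n) < e.

(* ip is an inner product (linear in the first argument, conjugate linear in
   the second) and H is complete for the induced norm *)
Definition is_hilbert : Prop :=
  [/\ (forall (a : R[i]) (f g h : H), ip (a *: f + g) h = a * ip f h + ip g h),
      (forall f g : H, ip g f = (ip f g)^*),
      (forall f : H, f != 0 -> 0 < ip f f) &
      (forall u : nat -> H, hcauchy u -> exists l : H, hconverges u l)].

(* An operator in H: a linear subspace D (its domain) and a map A linear on D *)
Definition is_operator (D : H -> Prop) (A : H -> H) : Prop :=
  [/\ D 0,
      (forall (a : R[i]) (f g : H), D f -> D g -> D (a *: f + g)) &
      (forall (a : R[i]) (f g : H), D f -> D g -> A (a *: f + g) = a *: A f + A g)].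

Definition densely_defined (D : H -> Prop) : Prop :=
  forall (f : H) (e : R), 0 < e -> exists g : H, D g /\ hnorm (f - g) < e.

Definition closed_op (D : H -> Prop) (A : H -> H) : Prop :=
  forall (u : nat -> H) (f g : H), (forall n, D (u n)) ->
    hconverges u f -> hconverges (fun n => A (u n)) g -> D f /\ A f = g.

Definition symmetric_op (D : H -> Prop) (A : H -> H) : Prop :=
  forall f g : H, D f -> D g -> ip (A f) g = ip f (A g).

(* deficiency subspace ker (A^* - lam) : the g in Dom(A^* ) with A^* g = lam g *)
Definition deficiency_space (D : H -> Prop) (A : H -> H) (lam : R[i]) (g : H) : Prop :=
  forall f : H, D f -> ip (A f) g = ip f (lam *: g).

(* a subspace is finite dimensional: spanned by a finite family *)
Definition finite_dim (N : H -> Prop) : Prop :=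
  exists s : seq H, forall g : H, N g ->
    exists c : seq R[i], g = \sum_(k < size s) c`_k *: s`_k.

Definition finite_deficiency (D : H -> Prop) (A : H -> H) : Prop :=
  finite_dim (deficiency_space D A 'i) /\ finite_dim (deficiency_space D A (- 'i)).

Definition extends (D : H -> Prop) (A : H -> H) (D' : H -> Prop) (A' : H -> H) : Prop :=
  forall f : H, D f -> D' f /\ A' f = A f.

Definition dissipative (D : H -> Prop) (A : H -> H) : Prop :=
  is_operator D A /\ forall f : H, D f -> 0 <= complex.Im (ip (A f) f).

Definition maximal_dissipative (D : H -> Prop) (A : H -> H) : Prop :=
  dissipative D A /\
  forall (D' : H -> Prop) (A' : H -> H),
    extends D A D' A' -> dissipative D' A' -> forall f : H, D' f -> D f.

End Hilbert.

Section Affine.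
Variable R : realType.
(* an element (a, b) of R * R stands for the affine map x |-> a x + b *)
Definition in_aff (g : R * R) : Prop := 0 < g.1.
Definition aff_comp (g h : R * R) : R * R := (g.1 * h.1, g.1 * h.2 + g.2).
Definition aff_id : R * R := (1, 0).
Definition aff_inv (g : R * R) : R * R := (g.1^-1, - (g.2 / g.1)).
Definition aff_pow (g : R * R) (n : int) : R * R :=
  match n with
  | Posz m => iter m (aff_comp g) aff_id
  | Negz m => iter m.+1 (aff_comp (aff_inv g)) aff_id
  end.

(* G is the cyclic subgroup generated by some element of the affine group *)
Definition cyclic_aff_subgroup (G : R * R -> Prop) : Prop :=
  exists g0 : R * R, in_aff g0 /\ forall g, G g <-> exists n : int, g = aff_pow g0 n.

(* phi : R -> affine group is a continuous homomorphism (one-parameter subgroup) *)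
Definition one_parameter (phi : R -> R * R) : Prop :=
  [/\ (forall t, in_aff (phi t)),
      (forall s t, phi (s + t) = aff_comp (phi s) (phi t)) &
      (forall (t e : R), 0 < e -> exists d : R, 0 < d /\ forall s : R,
          `|s - t| < d -> `|(phi s).1 - (phi t).1| < e /\ `|(phi s).2 - (phi t).2| < e)].
End Affine.

Section Rep.
Variables (R : realType) (H : lmodType R[i]) (ip : H -> H -> R[i]).

(* g |-> U g is a unitary representation of the subgroup G of the affine group *)
Definition unitary_rep (G : R * R -> Prop) (U : R * R -> H -> H) : Prop :=
  [/\ (forall g, G g ->
         [/\ (forall (a : R[i]) (f h : H), U g (a *: f + h) = a *: U g f + U g h),
             (forall f h : H, ip (U g f) (U g h) = ip f h) &
             (forall f : H, exists h : H, U g h = f)]),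
      (forall g h, G g -> G h -> forall f, U (aff_comp g h) f = U g (U h f)) &
      (forall f, U (@aff_id R) f = f)].

Definition strongly_continuous (U : R * R -> H -> H) (phi : R -> R * R) : Prop :=
  forall (f : H) (t e : R), 0 < e -> exists d : R, 0 < d /\ forall s : R,
    `|s - t| < d -> hnorm ip (U (phi s) f - U (phi t) f) < e.

(* G-invariance: U_g (Dom A) = Dom A and U_g A U_g^* f = a A f + b f on Dom A,
   where U_g^* = U_g^{-1} = U_{g^{-1}} *)
Definition G_invariant (G : R * R -> Prop) (U : R * R -> H -> H)
    (D : H -> Prop) (A : H -> H) : Prop :=
  forall g, G g ->
    [/\ (forall f, D f -> D (U g f)),
        (forall f, D f -> exists h, D h /\ U g h = f) &
        (forall f, D f ->
           U g (A (U (aff_inv g) f)) = (g.1)%:C *: A f + (g.2)%:C *: f)].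
End Rep.

(* Main.v *)
Require Import Defs.
From mathcomp Require Import all_boot all_order all_algebra.
From mathcomp Require Import boolp classical_sets reals.
From mathcomp Require Import complex.
From mathcomp Require Import ring lra.
Import Order.TTheory GRing.Theory Num.Theory ComplexField.
Local Open Scope ring_scope.

(** By von Neumann's decomposition the graph of A^* is finite dimensional modulo
    the graph of A, and dissipative extensions of A correspond to nonnegative
    subspaces of it for the boundary form -i((A^* f, f') - (f, A^* f')).  Each g
    in G induces a linear map of graphs that multiplies the boundary form by a
    positive scalar, and these maps commute since G is abelian.  Let W be maximal
    among the invariant nonnegative subspaces containing the graph of A.  If its
    orthogonal complement contained a positive vector, then common eigenvectors
    modulo the isotropic part of W, split off one by one as long as they are
    negative, would produce an invariant nonnegative line to be added to W.  So the
    complement is nonpositive, and W is maximal among all nonnegative subspaces. *)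

(** * Commuting families and hermitian forms *)

Section Relative.
Context {C : numClosedFieldType} {V : lmodType C}.
Implicit Types (N W : V -> Prop) (T : V -> V).

Definition subspace W := W 0 /\ forall a x y, W x -> W y -> W (a *: x + y).

Lemma subspaceD W x y : subspace W -> W x -> W y -> W (x + y).
Proof. by move=> sW Wx Wy; rewrite -[x]scale1r; apply: sW.2. Qed.

Lemma subspaceZ W a x : subspace W -> W x -> W (a *: x).
Proof. by move=> sW Wx; rewrite -[_ *: _]addr0; apply: sW.2 => //; apply: sW.1. Qed.

Lemma subspaceB W x y : subspace W -> W x -> W y -> W (x - y).
Proof.
by move=> sW Wx Wy; rewrite -scaleN1r; apply: subspaceD => //; apply: subspaceZ.
Qed.

Lemma subspace_sum W n (x : 'I_n -> V) :
  subspace W -> (forall i, W (x i)) -> W (\sum_i x i).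
Proof.
by move=> sW Wx; elim/big_ind: _ => [|y z Wy Wz|i _ //]; [exact: sW.1|exact: subspaceD].
Qed.

Definition linear_map T := forall a x y, T (a *: x + y) = a *: T x + T y.

Lemma linear_map0 T : linear_map T -> T 0 = 0.
Proof.
by move=> lT; have := lT (-1) 0 0; rewrite scaler0 addr0 scaleN1r addNr.
Qed.

Lemma linear_mapD T x y : linear_map T -> T (x + y) = T x + T y.
Proof. by move=> lT; rewrite -{1}[x]scale1r lT scale1r. Qed.

Lemma linear_mapZ T a x : linear_map T -> T (a *: x) = a *: T x.
Proof. by move=> lT; rewrite -[a *: x]addr0 lT linear_map0 ?addr0. Qed.

Lemma linear_mapB T x y : linear_map T -> T (x - y) = T x - T y.
Proof. by move=> lT; rewrite -scaleN1r addrC lT scaleN1r addrC. Qed.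

Lemma linear_map_sum T n (x : 'I_n -> V) :
  linear_map T -> T (\sum_i x i) = \sum_i T (x i).
Proof.
move=> lT; elim/big_ind2: _ => [|x1 y1 x2 y2 <- <-|//]; first exact: linear_map0.
exact: linear_mapD.
Qed.

(* stands for d <= dim (W / N), without forming the quotient *)
Definition indep N W d := exists x : 'I_d -> V, (forall i, W (x i)) /\
  forall c : 'I_d -> C, N (\sum_i c i *: x i) -> forall i, c i = 0.

Lemma indep0 N W : indep N W 0.
Proof. by exists (fun=> 0); split=> [[]|c _ []]. Qed.

Lemma indep_sub N N' W W' d : (forall x, N' x -> N x) -> (forall x, W x -> W' x) ->
  indep N W d -> indep N' W' d.
Proof.
move=> sN sW [x [Wx ix]]; exists x; split=> [i|c Nc]; first exact/sW/Wx.
exact/ix/sN.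
Qed.

(** The vector [w] is put at index 0 in front of the family from [W']. In a relation modulo [N] its
    coefficient must vanish, since otherwise [w] would lie in [W']. This is the dimension drop
    behind the inductions below. *)
Lemma indep_proper N W W' w d : subspace W' -> (forall x, N x -> W' x) ->
  (forall x, W' x -> W x) -> W w -> ~ W' w -> indep N W' d -> indep N W d.+1.
Proof.
move=> sW' sN sW Ww W'w [x [W'x ix]].
exists (fun i => oapp x w (unlift ord0 i)); split=> [i|c].
  by case: (unlift _ _) => [j|] //=; apply/sW/W'x.
rewrite big_ord_recl unlift_none /=.
under eq_bigr => i _ do rewrite liftK /=.
move=> Nc; have W's : W' (\sum_i c (lift ord0 i) *: x i).
  by apply: subspace_sum => // i; apply: subspaceZ.
have c0 : c ord0 = 0.
  apply/eqP/negPn/negP => c0; apply: W'w.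
  have /(subspaceZ _ (c ord0)^-1 _ sW') := subspaceB _ _ _ sW' (sN _ Nc) W's.
  by rewrite addrK scalerA mulVf // scale1r.
rewrite c0 scale0r add0r in Nc => i.
case: (unliftP ord0 i) => [j|] -> //; exact: (ix (fun j => c (lift ord0 j))).
Qed.

Lemma span_dep (J : finType) N W (s : J -> V) : subspace N ->
  (forall x, W x -> exists c : J -> C, N (x - \sum_j c j *: s j)) ->
  ~ indep N W #|J|.+1.
Proof.
move=> sN sp [x [Wx ix]].
have [c cP] := choice (fun i => sp (x i) (Wx i)).
pose M : 'M_(#|J|.+1, #|J|) := \matrix_(i, j) c i (enum_val j).
(* There is one more row than columns, so the coefficients have a nontrivial left kernel, which
   gives a relation modulo [N]. *)
have : kermx M != 0 by rewrite kermx_eq0 /row_free neq_ltn ltnS rank_leq_col.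
move=> /rowV0Pn [u /sub_kermxP uM u0].
case/eqP: u0; apply/rowP => i; rewrite mxE; apply: (ix (fun i => u ord0 i)).
have -> : \sum_i u ord0 i *: x i =
    \sum_i u ord0 i *: (x i - \sum_j c i j *: s j).
  under [RHS]eq_bigr => k _ do rewrite scalerBr scaler_sumr.
  rewrite sumrB exchange_big /= [X in _ - X]big1 ?subr0 // => j _.
  under eq_bigr => k _ do rewrite scalerA.
  rewrite -scaler_suml; have /rowP/(_ (enum_rank j)) := uM; rewrite !mxE.
  by under eq_bigr => k _ do rewrite mxE enum_rankK; move=> ->; rewrite scale0r.
by apply: subspace_sum => // k; apply: subspaceZ.
Qed.

(** Induction on the size of a polynomial [p] that sends [v] into [N]. A root [l] gives
    [p = q * ('X - l%:P)]. Either [q] applied to [v] is already in [N], and [q] replaces [p], or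
    that vector is the eigenvector. A nonzero constant [p] would force [v] into [N]. *)
Lemma eigenvector_of_poly N W T v : subspace N -> subspace W -> linear_map T ->
  (forall x, W x -> W (T x)) -> W v -> ~ N v ->
  forall n (p : {poly C}), (size p <= n)%N -> p != 0 ->
    N (\sum_(i < n) p`_i *: iter i T v) ->
  exists l w, [/\ W w, ~ N w & N (T w - l *: w)].
Proof.
move=> sN sW lT TW Wv Nv; have WT i : W (iter i T v) by elim: i => //= i; apply: TW.
elim=> [|n IHn] p; first by rewrite leqn0 size_poly_eq0 => /eqP->; rewrite eqxx.
move=> szp p0; have [/size_poly1P [c c0 pE]|szp1] := boolP (size p == 1)%N.
  rewrite big_ord_recl big1 ?addr0 /=; last by move=> i _; rewrite pE coefC scale0r.
  rewrite pE coefC /= => /(subspaceZ _ c^-1 _ sN).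
  by rewrite scalerA mulVf // scale1r.
have /closed_rootP [l /factor_theorem [q pE]] := szp1.
have q0 : q != 0 by apply: contra_neq p0 => q0; rewrite pE q0 mul0r.
have szq : (size q <= n)%N.
  by move: szp; rewrite pE size_Mmonic ?monicXsubC // size_XsubC addn2.
pose w := \sum_(i < n) q`_i *: iter i T v.
have -> : \sum_(i < n.+1) p`_i *: iter i T v = T w - l *: w.
  rewrite pE mulrBr; under eq_bigr => i _ do rewrite coefB coefMX coefMC scalerBl.
  rewrite sumrB big_ord_recl /= scale0r add0r; congr (_ - _).
    by rewrite linear_map_sum //; apply: eq_bigr => i _; rewrite linear_mapZ.
  rewrite big_ord_recr /= (nth_default 0 szq) mul0r scale0r addr0 scaler_sumr.
  by apply: eq_bigr => i _; rewrite mulrC scalerA.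
move=> Np; have [Nw|Nw] := EM (N w); first exact: (IHn q).
exists l, w; split=> //; apply: subspace_sum => // i; exact: subspaceZ.
Qed.

(** Without an eigenvector the iterates of [v] under [T] would be independent modulo [N]: a relation
    among them is an annihilating polynomial for [v]. *)
Lemma eigenvector_mod N W T v d : subspace N -> subspace W -> linear_map T ->
  (forall x, W x -> W (T x)) -> W v -> ~ N v -> ~ indep N W d ->
  exists l w, [/\ W w, ~ N w & N (T w - l *: w)].
Proof.
move=> sN sW lT TW Wv Nv nind.
apply: contrapT => noeig; apply: nind; exists (fun i => iter i T v); split.
  by move=> i; elim: (nat_of_ord i) => //= k; apply: TW.
move=> c Nc i; apply: contrapT => ci0; apply: noeig.
(* The default 0 is never reached, since [k < d]. *)
pose p := \poly_(k < d) (if insub k is Some j then c j else 0).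
have pE (j : 'I_d) : p`_j = c j by rewrite coef_poly ltn_ord valK.
apply: (eigenvector_of_poly N W T v sN sW lT TW Wv Nv d p); first exact: size_poly.
  by apply/eqP => p0; apply: ci0; rewrite -pE p0 coef0.
by under eq_bigr => j _ do rewrite pE.
Qed.

(** * Common eigenvectors of commuting families *)

Section Family.
Context {I : Type} (T : I -> V -> V).
Hypothesis linT : forall i, linear_map (T i).
Hypothesis comT : forall i j x, T i (T j x) = T j (T i x).

Definition invariant W := forall i x, W x -> W (T i x).

(** Induction on the dimension bound. If [v] is not a common eigenvector, some [T i] has an
    eigenspace modulo [N] that misses [v]. It is nonzero modulo [N], of smaller dimension, and
    invariant because the family commutes. *)
Lemma common_eigenvector_mod N W v d : subspace N -> subspace W ->
  invariant N -> invariant W -> (forall x, N x -> W x) ->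
  W v -> ~ N v -> ~ indep N W d ->
  exists w, [/\ W w, ~ N w & forall i, exists l, N (T i w - l *: w)].
Proof.
move=> sN + iN; elim: d W v => [|d IHd] W v sW iW NW Wv Nv.
  by case; apply: indep0.
move=> nind; apply: contrapT => noeig.
apply: (noeig); exists v; split=> // i.
have [l [w [Ww Nw Nl]]] :=
  eigenvector_mod N W (T i) v _ sN sW (linT i) (iW i) Wv Nv nind.
exists l; apply: contrapT => Nvl.
pose W' x := W x /\ N (T i x - l *: x).
have sW' : subspace W'.
  split=> [|a x y [Wx Nx] [Wy Ny]].
    by split; [apply: sW.1|rewrite linear_map0 // scaler0 subr0; apply: sN.1].
  split; first exact: sW.2.
  rewrite linT scalerDr opprD addrACA scalerA [l * a]mulrC -scalerA -scalerBr.
  exact: sN.2.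
have iW' : invariant W'.
  move=> j x [Wx Nx]; split; first exact: iW.
  rewrite comT -linear_mapZ // -linear_mapB //; exact: iN.
have NW' x : N x -> W' x.
  move=> Nx; split; first exact: NW.
  by apply: subspaceB => //; [apply: iN|apply: subspaceZ].
apply: noeig.
have [|u [[Wu _] Nu eu]] := IHd W' w sW' iW' NW' (conj Ww Nl) Nw.
  apply: contra_not nind; apply: (indep_proper _ _ _ v) => //; first by move=> x [].
  by case.
by exists u.
Qed.
End Family.


(** * Hermitian forms and their nonnegative subspaces *)

Section Form.
Implicit Type b : V -> V -> C.

Definition hermitian_form b := (forall a x y z, b (a *: x + y) z = a * b x z + b y z)
  /\ forall x y, b y x = (b x y)^*.
Definition nonneg_on b W := forall x, W x -> 0 <= b x x.

Lemma hermitian_formN b : hermitian_form b -> hermitian_form (fun x y => - b x y).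
Proof.
by case=> bl bh; split=> [a x y z|x y]; [rewrite bl opprD mulrN|rewrite bh rmorphN].
Qed.

Lemma hformDZr b a x y z : hermitian_form b -> b z (a *: x + y) = a^* * b z x + b z y.
Proof.
by case=> bl bh; rewrite bh bl rmorphD rmorphM /= -!bh.
Qed.

Lemma hform0l b z : hermitian_form b -> b 0 z = 0.
Proof.
case=> bl _; have := bl (-1) 0 0 z.
by rewrite scaler0 addr0 mulN1r addNr.
Qed.

Lemma hform0r b z : hermitian_form b -> b z 0 = 0.
Proof. by move=> hb; rewrite hb.2 hform0l // rmorph0. Qed.

Lemma hformC0 b x y : hermitian_form b -> b x y = 0 -> b y x = 0.
Proof. by move=> hb bxy; rewrite hb.2 bxy rmorph0. Qed.

Lemma hformBl b x y z : hermitian_form b -> b (x - y) z = b x z - b y z.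
Proof. by case=> bl _; rewrite -scaleN1r addrC bl mulN1r addrC. Qed.

Lemma hformDl b x y z : hermitian_form b -> b (x + y) z = b x z + b y z.
Proof. by case=> bl _; rewrite -[x]scale1r bl mul1r scale1r. Qed.

Lemma hformDr b x y z : hermitian_form b -> b z (x + y) = b z x + b z y.
Proof. by move=> hb; rewrite -[x]scale1r hformDZr // rmorph1 mul1r scale1r. Qed.

Lemma hformBr b x y z : hermitian_form b -> b z (x - y) = b z x - b z y.
Proof.
by move=> hb; rewrite -scaleN1r addrC hformDZr // rmorphN1 mulN1r addrC.
Qed.

Lemma hformZl b a x z : hermitian_form b -> b (a *: x) z = a * b x z.
Proof. by move=> hb; rewrite -[a *: x]addr0 hb.1 hform0l // addr0. Qed.

Lemma hformZr b a x z : hermitian_form b -> b z (a *: x) = a^* * b z x.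
Proof. by move=> hb; rewrite -[a *: x]addr0 hformDZr // hform0r // addr0. Qed.

(** The degenerate case of the Cauchy-Schwarz inequality: a neutral vector of a nonnegative subspace
    lies in its radical. *)
Lemma neutral_orthogonal b W x y : hermitian_form b -> subspace W ->
  nonneg_on b W -> W x -> b x x = 0 -> W y -> b x y = 0.
Proof.
move=> hb sW pW Wx bxx Wy; apply/eqP/negPn/negP => z0.
set z := b x y in z0.
have n0 : `|z| ^+ 2 != 0 by rewrite expf_neq0 // normr_eq0.
pose s := (b y y + 1) / 2 / `|z| ^+ 2.
have sr : s^* = s.
  apply: geC0_conj; rewrite /s !divr_ge0 ?addr_ge0 ?exprn_ge0 ?ler0n ?ler01 //.
  exact: pW.
have := pW _ (sW.2 (- (s * z^*)) _ _ Wx Wy).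
rewrite hb.1 !hformDZr // bxx -/z (hb.2 x y) -/z mulr0 add0r.
rewrite rmorphN rmorphM /= conjCK sr !mulNr -!mulrA [z^* * z]mulrC -normCK.
rewrite mulVf // mulr1 addrA -opprD -splitr opprD addrAC addNr add0r.
by rewrite oppr_ge0 lt_geF ?ltr01.
Qed.

(** Induction on the dimension of [W] modulo [N]. If all of [W] is neutral, 0 is a projection.
    Otherwise some [v] in [W] has [b v v != 0]; [f] is projected onto the orthogonal complement of
    [v] in [W], and the result is corrected by a multiple of [v]. *)
Lemma nonneg_projection b N W f d : hermitian_form b -> subspace W ->
  nonneg_on b W -> (forall x, N x -> W x) -> (forall x, N x -> b x x = 0) ->
  ~ indep N W d -> (forall x, W x -> b x x = 0 -> b f x = 0) ->
  exists n, W n /\ forall y, W y -> b (f - n) y = 0.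
Proof.
move=> hb; elim: d W => [|d IHd] W sW pW NW N0 nind f0; first by case: nind; apply: indep0.
have [neutral|] := EM (forall v, W v -> b v v = 0).
  by exists 0; split=> [|y Wy]; [apply: sW.1|rewrite subr0; apply/f0/neutral].
move/existsNP => [v /not_implyP [Wv bvv]].
pose W' x := W x /\ b x v = 0.
have sW' : subspace W'.
  split=> [|a x y [Wx bx] [Wy by_]]; first by split; [apply: sW.1|apply: hform0l].
  by split; [apply: sW.2|rewrite hb.1 bx by_ mulr0 addr0].
have NW' x : N x -> W' x.
  move=> Nx; split; first exact: NW.
  by apply: (neutral_orthogonal b W) => //; [exact: NW|exact: N0].
have [|||n [[Wn nv] nP]] := IHd W' sW' _ NW' N0.
- by move=> x [Wx _]; apply: pW.
- apply: contra_not nind; apply: (indep_proper _ _ _ v) => //; first by move=> x [].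
  by case.
- by move=> x [Wx _]; apply: f0.
have bvv0 : b v v != 0 by apply/eqP.
pose a := b f v / b v v; exists (n + a *: v); split.
  by apply: subspaceD => //; apply: subspaceZ.
have gv : b (f - (n + a *: v)) v = 0.
  by rewrite opprD addrA !hformBl // nv subr0 hformZl // /a divfK // subrr.
move=> y Wy; pose k := b y v / b v v.
have W'y : W' (y - k *: v).
  split; first by apply: subspaceB => //; apply: subspaceZ.
  by rewrite hformBl // hformZl // divfK // subrr.
rewrite -[y](subrK (k *: v)) hformDr // hformZr // gv mulr0 addr0.
rewrite opprD addrA hformBl // nP // hformZl //.
by rewrite (hformC0 _ _ _ hb W'y.2) mulr0 subrr.
Qed.

(** The point of the conclusion is that [W] is maximal even among nonnegative subspaces that are not
    invariant. In the application [N] is the graph of the symmetric operator, and its orthogonal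
    space is the graph of the adjoint. *)
Lemma invariant_maximal_nonneg (I : Type) (T : I -> V -> V) b N d :
  (forall i, linear_map (T i)) ->
  (forall i j x, T i (T j x) = T j (T i x)) ->
  (forall i, exists j, forall x, T i (T j x) = x) ->
  (forall i, exists c, forall x y, b (T i x) (T i y) = c * b x y) ->
  hermitian_form b -> subspace N -> invariant T N -> (forall x, N x -> b x x = 0) ->
  ~ indep N (fun x => forall y, N y -> b x y = 0) d ->
  exists W, [/\ subspace W, forall x, N x -> W x, nonneg_on b W, invariant T W &
    forall W', subspace W' -> nonneg_on b W' -> (forall x, W x -> W' x) ->
      forall x, W' x -> W x].
Proof.
move=> linT comT invT scaleT hb sN iN N0 nind.
pose good W := [/\ subspace W, forall x, N x -> W x, nonneg_on b W & invariant T W].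
have sub_perp W : subspace W -> nonneg_on b W -> (forall x, N x -> W x) ->
    forall x, W x -> forall y, N y -> b x y = 0.
  move=> sW pW NW x Wx y Ny; apply: hformC0 => //.
  by apply: (neutral_orthogonal b W) => //; [exact: NW|exact: N0].
have [W [[sW NW pW iW] maxW]] : exists W, good W /\
    forall W', good W' -> (forall x, W x -> W' x) -> forall x, W' x -> W x.
  apply: contrapT => nomax.
  (* If no invariant candidate were maximal, strict enlargements would reach every dimension modulo
     [N]. But a nonnegative subspace containing the neutral [N] lies in the orthogonal space of [N],
     whose dimension modulo [N] is bounded. *)
  have chain m : exists W, good W /\ indep N W m.
    elim: m => [|m [W [gW iWm]]].
      exists N; split; last exact: indep0.
      by split=> // x Nx; rewrite N0.
    apply: contrapT => noind; apply: nomax; exists W; split=> // W' gW' WW' x W'x.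
    apply: contrapT => Wx; apply: noind; exists W'; split=> //.
    by case: gW => sW NW _ _; apply: (indep_proper _ _ W x).
  have [W [[sW NW pW _] iWd]] := chain d; apply: nind.
  by apply: (indep_sub _ _ _ _ _ _ _ iWd) => //; apply: sub_perp.
pose P x := forall y, W y -> b x y = 0.
have sP : subspace P.
  split=> [y _|a x y Px Py z Wz]; first exact: hform0l.
  by rewrite hb.1 Px // Py // mulr0 addr0.
(* Writing [y = T i (T j y)] moves [T i] off [x] at the cost of a scalar, and [W] contains
   [T j y]. *)
have iP : invariant T P.
  move=> i x Px y Wy; have [j Tj] := invT i; have [c Tc] := scaleT i.
  by rewrite -(Tj y) Tc Px ?mulr0 //; apply: iW.
pose N0' x := W x /\ P x.
have sN0 : subspace N0'.
  split=> [|a x y [Wx Px] [Wy Py]]; first by split; [exact: sW.1|exact: sP.1].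
  by split; [exact: sW.2|exact: sP.2].
have iN0 : invariant T N0' by move=> i x [Wx Px]; split; [exact: iW|exact: iP].
have NN0 x : N x -> N0' x.
  move=> Nx; split; first exact: NW.
  by move=> y Wy; apply: hformC0 => //; apply: (sub_perp W).
(* A nonnegative line in [P], invariant modulo [N0'], may be added to [W] orthogonally; by
   maximality it is already there. *)
have enlarge v : P v -> 0 <= b v v ->
    (forall i, exists l, N0' (T i v - l *: v)) -> W v.
  move=> Pv vv ev.
  pose W1 x := exists w a, W w /\ x = w + a *: v.
  have WW1 x : W x -> W1 x by move=> Wx; exists x, 0; rewrite scale0r addr0.
  apply: (maxW W1) => //; last first.
    by exists 0, 1; rewrite add0r scale1r; split=> //; apply: sW.1.
  split.
  - split=> [|k _ _ [w [a [Ww ->]]] [w' [a' [Ww' ->]]]]; first exact/WW1/sW.1.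
    exists (k *: w + w'), (k * a + a'); split; first exact: sW.2.
    by rewrite scalerDr scalerA addrACA -scalerDl.
  - by move=> x /NW /WW1.
  - move=> _ [w [a [Ww ->]]].
    rewrite hformDl // !hformDr // !hformZl // !hformZr // Pv // (hformC0 _ _ _ hb (Pv _ Ww)).
    by rewrite !mulr0 addr0 add0r mulrA -normCK addr_ge0 ?mulr_ge0 ?exprn_ge0 //; apply: pW.
  - move=> i _ [w [a [Ww ->]]]; have [l [Wl _]] := ev i.
    exists (T i w + a *: (T i v - l *: v)), (a * l); split.
      by apply: subspaceD => //; [apply: iW|apply: subspaceZ].
    by rewrite linear_mapD // linear_mapZ // scalerBr scalerA -addrA subrK.
(* Induction on the dimension of [Q] modulo the radical [N0'] of [W]. A common eigenvector [v]
   outside [N0'] is negative by [enlarge], and its orthogonal complement [Q'] in [Q] is handled by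
   induction. Then [x] is the orthogonal sum of a vector of [Q'] and a multiple of [v]. *)
have descent e Q : subspace Q -> invariant T Q -> (forall x, N0' x -> Q x) ->
    (forall x, Q x -> P x) -> ~ indep N0' Q e -> forall x, Q x -> b x x <= 0.
  elim: e Q => [|e IHe] Q sQ iQ NQ QP nindQ; first by case: nindQ; apply: indep0.
  move=> x Qx; have [[Wx Px]|Nx] := EM (N0' x); first by rewrite Px.
  have [v [Qv Nv ev]] :=
    common_eigenvector_mod T linT comT N0' Q x _ sN0 sQ iN0 iQ NQ Qx Nx nindQ.
  have Pv := QP _ Qv.
  have vneg : b v v < 0.
    rewrite real_ltNge ?real0 //; last by rewrite CrealE -hb.2.
    by apply/negP => vv; apply: Nv; split=> //; apply: enlarge.
  have v0 : b v v != 0 by rewrite lt_eqF.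
  pose Q' x := Q x /\ b x v = 0.
  have Q'neg : forall y, Q' y -> b y y <= 0.
    apply: IHe.
    - split=> [|a y z [Qy yv] [Qz zv]]; first by split; [exact: sQ.1|exact: hform0l].
      by split; [exact: sQ.2|rewrite hb.1 yv zv mulr0 addr0].
    - move=> i y [Qy yv]; split; first exact: iQ.
      (* [Q'] is invariant: up to a scalar, [b (T i y) v] is [b y (T j v)], where [T j v] is
         [l *: v] plus a vector of [W], to which [y] in [P] is orthogonal. *)
      have [j Tj] := invT i; have [c Tc] := scaleT i; have [l [Wl _]] := ev j.
      rewrite -(Tj v) Tc -(subrK (l *: v) (T j v)) hformDr // hformZr // yv.
      by rewrite (QP _ Qy) // mulr0 addr0 mulr0.
    - move=> y [Wy Py]; split; first by apply: NQ.
      by apply: hformC0 => //; apply: Pv.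
    - by move=> y [Qy _]; apply: QP.
    - apply: contra_not nindQ; apply: (indep_proper _ _ _ v) => //.
      + split=> [|a y z [Qy yv] [Qz zv]]; first by split; [exact: sQ.1|exact: hform0l].
        by split; [exact: sQ.2|rewrite hb.1 yv zv mulr0 addr0].
      + move=> y [Wy Py]; split; first by apply: NQ.
        by apply: hformC0 => //; apply: Pv.
      + by move=> y [].
      + by case=> _ /eqP; apply/negP.
  pose k := b x v / b v v.
  have Q'y : Q' (x - k *: v).
    split; first by apply: subspaceB => //; apply: subspaceZ.
    by rewrite hformBl // hformZl // divfK // subrr.
  rewrite -[x](subrK (k *: v)); move: (x - _) Q'y => y Q'y.
  rewrite hformDl // !hformDr // !hformZl // !hformZr // Q'y.2.
  rewrite (hformC0 _ _ _ hb Q'y.2) !mulr0 addr0 add0r mulrA -normCK.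
  rewrite -[0]addr0 lerD ?Q'neg // mulr_ge0_le0 ?exprn_ge0 //; exact: ltW.
have Pneg x : P x -> b x x <= 0.
  apply: (descent d P) => //; first by move=> y [].
  apply: contra_not nind; apply: indep_sub => // y Py z Nz.
  by apply: Py; apply: NW.
have hbN := hermitian_formN _ hb.
have PposN : nonneg_on (fun x y => - b x y) P by move=> y Py; rewrite oppr_ge0 Pneg.
(* the radical Z of the semidefinite form on P is invariant, so W + Z competes with W *)
have neutralP v : P v -> b v v = 0 -> W v.
  move=> Pv vv; pose Z x := P x /\ forall y, P y -> b x y = 0.
  have sZ : subspace Z.
    split=> [|a x y [Px Zx] [Py Zy]].
      by split=> [|y _]; [exact: sP.1|exact: hform0l].
    by split=> [|z Pz]; [exact: sP.2|rewrite hb.1 Zx // Zy // mulr0 addr0].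
  have iZ : invariant T Z.
    move=> i x [Px Zx]; split=> [|y Py]; first exact: iP.
    have [j Tj] := invT i; have [c Tc] := scaleT i.
    by rewrite -(Tj y) Tc Zx ?mulr0 //; apply: iP.
  have Zv : Z v.
    split=> // y Py; apply/eqP; rewrite -oppr_eq0; apply/eqP.
    by apply: (neutral_orthogonal _ P v y hbN) => //; rewrite vv oppr0.
  pose W1 x := exists w z, [/\ W w, Z z & x = w + z].
  have WW1 x : W x -> W1 x by move=> Wx; exists x, 0; rewrite addr0; split=> //; apply: sZ.1.
  apply: (maxW W1) => //; last first.
    by exists 0, v; rewrite add0r; split=> //; apply: sW.1.
  split.
  - split=> [|k _ _ [w [z [Ww Zz ->]]] [w' [z' [Ww' Zz' ->]]]]; first exact/WW1/sW.1.
    exists (k *: w + w'), (k *: z + z'); split; [exact: sW.2|exact: sZ.2|].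
    by rewrite scalerDr addrACA.
  - by move=> x /NW /WW1.
  - move=> _ [w [z [Ww [Pz Zz] ->]]].
    rewrite hformDl // !hformDr // Pz // (hformC0 _ _ _ hb (Pz _ Ww)) Zz //.
    by rewrite !addr0; apply: pW.
  - move=> i _ [w [z [Ww Zz ->]]]; exists (T i w), (T i z).
    by split; [exact: iW|exact: iZ|rewrite linear_mapD].
exists W; split=> // W' sW' pW' WW' f W'f.
(* The projection of [f] onto [W] exists because neutral vectors of [W] are neutral in [W'], hence
   orthogonal to [f]. The remainder [f - n] lies in both [P] and [W'], so it is nonpositive and
   nonnegative, hence neutral, hence in [W]. *)
have [||n [Wn nP]] := nonneg_projection b N W f d hb sW pW NW N0.
- by apply: contra_not nind; apply: indep_sub => //; apply: sub_perp.
- move=> x Wx xx; apply: hformC0 => //.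
  by apply: (neutral_orthogonal b W') => //; apply: WW'.
have Pp : P (f - n) by [].
rewrite -(subrK n f); apply: subspaceD => //; apply: neutralP => //.
apply/eqP; rewrite eq_le Pneg //=; apply: pW'.
by apply: subspaceB => //; apply: WW'.
Qed.
End Form.
End Relative.

(** * Hilbert space geometry *)

Local Open Scope complex_scope.

Section HilbertSpace.
Context {R : realType} {H : lmodType R[i]} (ip : H -> H -> R[i]).
Hypothesis hH : is_hilbert ip.

Lemma hilbert_hermitian : hermitian_form ip.
Proof. by case: hH. Qed.
Let hb := hilbert_hermitian.

Lemma hnorm_ge0 x : 0 <= hnorm ip x.
Proof. exact: sqrtr_ge0. Qed.

Lemma ip_diag x : ip x x = (hnorm ip x ^+ 2)%:C.
Proof.
have : 0 <= ip x x.
  have [->|x0] := eqVneq x 0; first by rewrite (hform0l ip).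
  by apply: ltW; case: hH => _ _ + _; apply.
rewrite lecE /hnorm; case: (ip x x) => a b /= /andP [/eqP -> a0].
by rewrite sqr_sqrtr.
Qed.

Lemma hnorm_eq0 x : hnorm ip x = 0 -> x = 0.
Proof.
move=> nx; apply/eqP/negPn/negP => x0; case: hH => _ _ /(_ x x0) + _.
by rewrite ip_diag nx expr0n ltxx.
Qed.

Lemma hnorm0 : hnorm ip 0 = 0.
Proof. by rewrite /hnorm (hform0l ip) //= sqrtr0. Qed.

Lemma hnorm_sqr x : hnorm ip x ^+ 2 = complex.Re (ip x x).
Proof. by rewrite ip_diag. Qed.

Lemma hnorm_sqrZ (a : R[i]) x :
  hnorm ip (a *: x) ^+ 2 = (complex.Re a ^+ 2 + complex.Im a ^+ 2) * hnorm ip x ^+ 2.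
Proof.
rewrite hnorm_sqr (hformZl ip) // (hformZr ip) // ip_diag; case: a => p q /=; ring.
Qed.

Lemma hnorm_sqrD x y : hnorm ip (x + y) ^+ 2 =
  hnorm ip x ^+ 2 + 2 * complex.Re (ip x y) + hnorm ip y ^+ 2.
Proof.
rewrite hnorm_sqr (hformDl ip) //.
rewrite !(hformDr ip) // (hb.2 x y) (ip_diag x) (ip_diag y).
by case: (ip x y) => p q /=; ring.
Qed.

Lemma hnorm_sqr_inj x y : hnorm ip x ^+ 2 = hnorm ip y ^+ 2 -> hnorm ip x = hnorm ip y.
Proof. by move/eqP; rewrite eqrXn2 ?hnorm_ge0 // => /eqP. Qed.

Lemma hnormN x : hnorm ip (- x) = hnorm ip x.
Proof. by apply: hnorm_sqr_inj; rewrite -scaleN1r hnorm_sqrZ /=; ring. Qed.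

Lemma hnormiZ x : hnorm ip ('i%C *: x) = hnorm ip x.
Proof. by apply: hnorm_sqr_inj; rewrite hnorm_sqrZ /=; ring. Qed.

Lemma hnormBC x y : hnorm ip (x - y) = hnorm ip (y - x).
Proof. by rewrite -hnormN opprB. Qed.

Lemma Re_ip_le x y : complex.Re (ip x y) <= hnorm ip x * hnorm ip y.
Proof.
have [x0|x0] := eqVneq (hnorm ip x) 0.
  by rewrite (hnorm_eq0 _ x0) (hform0l ip) // hnorm0 mul0r.
have [y0|y0] := eqVneq (hnorm ip y) 0.
  by rewrite (hnorm_eq0 _ y0) (hform0r ip) // hnorm0 mulr0.
have xp : 0 < hnorm ip x by rewrite lt0r x0 hnorm_ge0.
have yp : 0 < hnorm ip y by rewrite lt0r y0 hnorm_ge0.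
(* Expanding the square norm of [|y| x - |x| y] gives the inequality multiplied by [2 |x| |y|]. *)
have := sqr_ge0 (hnorm ip ((hnorm ip y)%:C *: x + (- hnorm ip x)%:C *: y)).
rewrite hnorm_sqrD !hnorm_sqrZ (hformZl ip) // (hformZr ip) //.
case: (ip x y) => a b /= h; have xy := mulr_gt0 xp yp.
by rewrite -subr_ge0 -(pmulr_rge0 _ xy); lra.
Qed.

Lemma hnormD x y : hnorm ip (x + y) <= hnorm ip x + hnorm ip y.
Proof.
rewrite -ler_sqr ?nnegrE ?addr_ge0 ?hnorm_ge0 // hnorm_sqrD.
have := Re_ip_le x y; nra.
Qed.

Lemma hnorm_dist x y z : hnorm ip (x - z) <= hnorm ip (x - y) + hnorm ip (y - z).
Proof. by have := hnormD (x - y) (y - z); rewrite addrA subrK. Qed.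

Lemma hconverges_cauchy u l : hconverges ip u l -> hcauchy ip u.
Proof.
move=> ul e e0; have [N uN] := ul (e / 2) ltac:(lra); exists N => m n Nm Nn.
have := hnorm_dist (u m) l (u n); rewrite (hnormBC l).
have := uN _ Nm; have := uN _ Nn; lra.
Qed.

Lemma hconverges_unique u l l' : hconverges ip u l -> hconverges ip u l' -> l = l'.
Proof.
move=> ul ul'; apply/eqP; rewrite -subr_eq0; apply/eqP/hnorm_eq0/le_anti.
rewrite hnorm_ge0 andbT; apply/ler_addgt0Pl => e e0; rewrite addr0.
have [N uN] := ul (e / 2) ltac:(lra); have [N' uN'] := ul' (e / 2) ltac:(lra).
have := hnorm_dist l (u (maxn N N')) l'; rewrite (hnormBC l (u _)).
have := uN _ (leq_maxl N N'); have := uN' _ (leq_maxr N N'). lra.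
Qed.

Lemma hconvergesDi u v l l' : hconverges ip u l -> hconverges ip v l' ->
  hconverges ip (fun n => u n + 'i%C *: v n) (l + 'i%C *: l').
Proof.
move=> ul vl e e0.
have [N uN] := ul (e / 2) ltac:(lra); have [N' uN'] := vl (e / 2) ltac:(lra).
exists (maxn N N') => n; rewrite geq_max => /andP [/uN Nn /uN' Nn'].
rewrite opprD addrACA -scalerBr; apply: le_lt_trans (hnormD _ _) _.
rewrite hnormiZ; lra.
Qed.

(** A sequence in [S] minimizing the distance to [k] is Cauchy. Its limit attains the distance [d],
    and varying the minimizer along [s] gives orthogonality. *)
Lemma orthogonal_projection (S : H -> Prop) k : subspace S ->
  (forall u l, (forall n, S (u n)) -> hconverges ip u l -> S l) ->
  exists y, S y /\ forall s, S s -> ip (k - y) s = 0.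
Proof.
move=> sS closedS.
pose E : set R := [set hnorm ip (k - y) | y in S]%classic.
pose d := inf E.
have lbE : has_lbound E by exists 0 => _ [y _ <-]; apply: hnorm_ge0.
have iE : has_inf E.
  by split=> //; exists (hnorm ip (k - 0)), 0 => //; apply: sS.1.
have d0 : 0 <= d.
  by apply: (lb_le_inf iE.1) => _ [y _ <-]; apply: hnorm_ge0.
have dle y : S y -> d <= hnorm ip (k - y) by move=> Sy; apply: ge_inf => //; exists y.
have [u uP] : {u : nat -> H & forall n, S (u n) /\ hnorm ip (k - u n) < d + n.+1%:R^-1}.
  apply: (@choice _ _ (fun n v => S v /\ hnorm ip (k - v) < d + n.+1%:R^-1)) => n.
  have [|_ [y Sy <-] yd] := @inf_adherent _ E n.+1%:R^-1 _ iE.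
    by rewrite invr_gt0 ltr0n.
  by exists y.
have small (e : R) : 0 < e -> exists N, forall n, (N <= n)%N -> n.+1%:R^-1 < e.
  move=> e0; exists (Num.bound e^-1) => n Nn.
  rewrite -[e]invrK ltf_pV2 ?posrE ?invr_gt0 ?ltr0n //.
  apply: lt_le_trans (archi_boundP _) _; first by rewrite invr_ge0 ltW.
  by rewrite ler_nat; apply: leqW.
have cu : hcauchy ip u.
  (* Chosen so that the parallelogram bound satisfies [4 * r * (2 * d + r) < e ^+ 2]; the cap
     [r <= 1] makes the bound linear in [r]. *)
  move=> e e0; pose r := Num.min 1 (e ^+ 2 / (8 * d + 8)).
  have e2 : 0 < e ^+ 2 by rewrite exprn_gt0.
  have d8 : 0 < 8 * d + 8 by lra.
  have r0 : 0 < r by rewrite lt_min ltr01 divr_gt0.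
  have r1 : r <= 1 by rewrite ge_min lexx.
  have re : r * (8 * d + 8) <= e ^+ 2 by rewrite -ler_pdivlMr // ge_min lexx orbT.
  have [N NP] := small r r0; exists N => m n Nm Nn.
  have [Sm um] := uP m; have [Sn un] := uP n.
  have um' : hnorm ip (k - u m) < d + r by apply: lt_trans um _; rewrite ltrD2l NP.
  have un' : hnorm ip (k - u n) < d + r by apply: lt_trans un _; rewrite ltrD2l NP.
  have mid : d <= hnorm ip (k - (2^-1 : R[i]) *: (u m + u n)).
    by apply: dle; apply: subspaceZ => //; apply: subspaceD.
  have sumE : (k - u m) + (k - u n) = (2 : R[i]) *: (k - (2^-1 : R[i]) *: (u m + u n)).
    rewrite scalerBr scalerA mulfV ?pnatr_eq0 // scale1r scaler_nat mulr2n.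
    by rewrite opprD addrACA.
  (* parallelogram law for k - u m and k - u n *)
  have P1 := hnorm_sqrD (k - u m) (k - u n).
  have P2 := hnorm_sqrD (k - u m) (- (k - u n)).
  rewrite sumE hnorm_sqrZ /= in P1.
  have difE : (k - u m) - (k - u n) = u n - u m.
    by rewrite opprB addrC addrA subrK.
  rewrite difE (hnormBC (u n)) hnormN in P2.
  have ipN : complex.Re (ip (k - u m) (- (k - u n))) = - complex.Re (ip (k - u m) (k - u n)).
    by rewrite -[- (k - u n)]scaleN1r (hformZr ip) // rmorphN1 mulN1r; case: (ip _ _).
  rewrite ipN in P2.
  rewrite -(ltr_pXn2r (n := 2)) ?nnegrE ?hnorm_ge0 ?(ltW e0) //.
  move: P1 P2 mid um' un'; set a := hnorm ip (k - u m); set b := hnorm ip (k - u n).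
  have : 0 <= a by apply: hnorm_ge0.
  have : 0 <= b by apply: hnorm_ge0.
  move: (complex.Re (ip _ _)) => q; set c := hnorm ip (k - _ *: _).
  set z := hnorm ip (u m - u n); move=> b0 a0 P1 P2 dc ar br.
  have a2 : a ^+ 2 <= (d + r) ^+ 2 by rewrite ler_sqr ?nnegrE ?addr_ge0 // ltW.
  have b2 : b ^+ 2 <= (d + r) ^+ 2 by rewrite ler_sqr ?nnegrE ?addr_ge0 // ltW.
  have c2 : d ^+ 2 <= c ^+ 2 by rewrite ler_sqr ?nnegrE // (le_trans d0).
  have : z ^+ 2 <= 4 * r * (2 * d + r) by nra.
  nra.
have [_ _ _ complete] := hH; have [y uy] := complete u cu.
have Sy : S y by apply: closedS uy => n; case: (uP n).
have yd : hnorm ip (k - y) <= d.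
  apply/ler_addgt0Pr => e e0.
  have [N NP] := small (e / 2) ltac:(lra); have [N' NP'] := uy (e / 2) ltac:(lra).
  have := hnorm_dist k (u (maxn N N')) y; have [_] := uP (maxn N N').
  have := NP _ (leq_maxl N N'); have := NP' _ (leq_maxr N N').
  by move: ((maxn N N').+1%:R^-1) => r; lra.
exists y; split=> // s Ss; set w := k - y in yd *.
have wmin z : hnorm ip w ^+ 2 <= hnorm ip (w + z *: s) ^+ 2.
  rewrite ler_sqr ?nnegrE ?hnorm_ge0 //; apply: le_trans yd _.
  rewrite /w -addrA [- y + _]addrC -opprB; apply: dle.
  by apply: subspaceB => //; apply: subspaceZ.
clearbody w; pose t := (hnorm ip s ^+ 2 + 1)^-1.
have s1 : 0 < hnorm ip s ^+ 2 + 1 by rewrite ltr_wpDl ?sqr_ge0.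
have t0 : 0 < t by rewrite invr_gt0.
have ts : t * hnorm ip s ^+ 2 <= 1.
  by rewrite mulrC ler_pdivrMr // mul1r lerDl ler01.
(* This competitor changes the square norm by at most [- t * |ip w s|^2], because
   [t * hnorm ip s ^+ 2 <= 1]. Minimality then forces [ip w s = 0]. *)
have := wmin (- t%:C * ip w s); rewrite hnorm_sqrD (hformZr ip) // hnorm_sqrZ.
case: (ip w s) => a b /= h.
have [ab|ab] := eqVneq (a ^+ 2 + b ^+ 2) 0.
  move/eqP: ab; rewrite paddr_eq0 ?sqr_ge0 // !sqrf_eq0 => /andP [/eqP -> /eqP ->].
  by [].
have abp : 0 < a ^+ 2 + b ^+ 2 by rewrite lt0r ab addr_ge0 ?sqr_ge0.
have tab : 0 < t * (a ^+ 2 + b ^+ 2) by rewrite mulr_gt0.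
have : t * hnorm ip s ^+ 2 * (t * (a ^+ 2 + b ^+ 2)) <= t * (a ^+ 2 + b ^+ 2).
  by rewrite ger_pMl.
exfalso; move: h; nra.
Qed.

End HilbertSpace.

(** * Graphs, deficiency spaces and the boundary form *)

Section Operators.
Context {R : realType} {H : lmodType R[i]} (ip : H -> H -> R[i]).
Hypothesis hH : is_hilbert ip.
Let hb := hilbert_hermitian _ hH.

Lemma ipiZr x y : ip x ('i%C *: y) = - 'i%C * ip x y.
Proof. by rewrite (hformZr ip) // complexiE conjCi. Qed.

Lemma complexi_neq0 : 'i%C != 0 :> R[i].
Proof. by rewrite eq_complex /= oner_eq0 andbF. Qed.

(** A point [g] of [D] closer to [h] than [|h|] would contradict Pythagoras. *)
Lemma dense_orthogonal D h : densely_defined ip D ->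
  (forall g, D g -> ip g h = 0) -> h = 0.
Proof.
move=> dD h0; apply: contrapT => hn0.
have nh : 0 < hnorm ip h.
  by rewrite lt0r hnorm_ge0 andbT; apply/eqP => /(hnorm_eq0 _ hH).
have [g [Dg]] := dD h _ nh.
apply/negP; rewrite -leNgt -ler_sqr ?nnegrE ?hnorm_ge0 // hnorm_sqrD //.
rewrite hnormN // -scaleN1r (hformZr ip) // (hformC0 ip _ _ hb (h0 _ Dg)) mulr0 /=.
by rewrite mulr0 addr0 lerDl sqr_ge0.
Qed.

Lemma pair_sum n (F : 'I_n -> H * H) :
  \sum_i F i = (\sum_i (F i).1, \sum_i (F i).2).
Proof.
elim: n F => [|n IHn] F; first by rewrite !big_ord0.
by rewrite !big_ord_recl IHn.
Qed.

(** * Symmetric operators and von Neumann's decomposition *)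

Section Symmetric.
Variables (D : H -> Prop) (A : H -> H).
Hypothesis hA : is_operator D A.

Lemma domain_subspace : subspace D.
Proof. by case: hA. Qed.

Lemma operatorB f g : D f -> D g -> A (f - g) = A f - A g.
Proof.
by case: hA => _ _ lA Df Dg; rewrite -scaleN1r addrC lA // scaleN1r addrC.
Qed.

Definition graph (x : H * H) : Prop := D x.1 /\ x.2 = A x.1.

Lemma graph_subspace : subspace graph.
Proof.
case: hA => D0 lD lA; split=> [|a x y [Dx Ax] [Dy Ay]].
  by split=> //=; have := operatorB 0 0 D0 D0; rewrite !subrr.
by split=> /=; [apply: lD|rewrite Ax Ay lA].
Qed.

Hypothesis symA : symmetric_op ip D A.

(** By symmetry [ip (A g) g] is real, so the cross term vanishes. *)
Lemma hnorm_sqr_addi g : D g ->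
  hnorm ip (A g + 'i%C *: g) ^+ 2 = hnorm ip (A g) ^+ 2 + hnorm ip g ^+ 2.
Proof.
move=> Dg; rewrite hnorm_sqrD // hnormiZ // ipiZr.
have := hb.2 (A g) g; rewrite -symA //.
case: (ip (A g) g) => a b /= [ab]; suff -> : b = 0 by ring.
by lra.
Qed.

Hypothesis closedA : closed_op ip D A.

(** The range of [A + i] is closed: the norm of [A g + i g] controls both [A g] and [g], and [A] is
    closed. Its orthogonal complement is the kernel of [A^* - i]. *)
Lemma range_decomposition k : exists g w,
  [/\ D g, deficiency_space ip D A 'i%C w & k = A g + 'i%C *: g + w].
Proof.
pose S y := exists g, D g /\ y = A g + 'i%C *: g.
have [D0 lD lA] := hA.
have sS : subspace S.
  split=> [|a _ _ [f [Df ->]] [g [Dg ->]]].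
    exists 0; split=> //; rewrite scaler0 addr0.
    by have := operatorB 0 0 D0 D0; rewrite !subrr.
  exists (a *: f + g); split; first exact: lD.
  by rewrite lA // !scalerDr !scalerA [a * _]mulrC addrACA.
have closedS u l : (forall n, S (u n)) -> hconverges ip u l -> S l.
  move=> Su ul; have [v vP] := choice Su.
  have cu := hconverges_cauchy _ hH _ _ ul.
  have dist m n : hnorm ip (u m - u n) ^+ 2 =
      hnorm ip (A (v m) - A (v n)) ^+ 2 + hnorm ip (v m - v n) ^+ 2.
    have [Dm ->] := vP m; have [Dn ->] := vP n.
    rewrite opprD addrACA -scalerBr -operatorB // hnorm_sqr_addi //.
    by apply: subspaceB => //; apply: domain_subspace.
  have cv : hcauchy ip v.
    move=> e e0; have [N NP] := cu e e0; exists N => m n Nm Nn.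
    apply: le_lt_trans (NP m n Nm Nn).
    by rewrite -ler_sqr ?nnegrE ?hnorm_ge0 // dist lerDr sqr_ge0.
  have cAv : hcauchy ip (fun n => A (v n)).
    move=> e e0; have [N NP] := cu e e0; exists N => m n Nm Nn.
    apply: le_lt_trans (NP m n Nm Nn).
    by rewrite -ler_sqr ?nnegrE ?hnorm_ge0 // dist lerDl sqr_ge0.
  have [_ _ _ complete] := hH.
  have [f vf] := complete _ cv; have [h Avh] := complete _ cAv.
  have [|Df Af] := closedA v f h _ vf Avh; first by move=> n; case: (vP n).
  exists f; split=> //; rewrite Af.
  apply: (hconverges_unique _ hH u) => //.
  suff -> : u = fun n => A (v n) + 'i%C *: v n by apply: hconvergesDi.
  by apply/funext => n; case: (vP n).
have [y [[g [Dg ->]] yP]] := orthogonal_projection _ hH S k sS closedS.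
exists g, (k - (A g + 'i%C *: g)); split=> //; last by rewrite addrC subrK.
move=> f Df; have /(hformC0 ip _ _ hb) := yP _ (ex_intro _ f (conj Df erefl)).
rewrite (hformDl ip) // (hformZl ip) // ipiZr mulNr.
by move/eqP; rewrite addr_eq0 => /eqP.
Qed.

(* the boundary form (A^* f, f') - (f, A^* f') on pairs (f, A^* f), divided by i *)
Definition boundary_form (x y : H * H) : R[i] := 'i%C * (ip x.1 y.2 - ip x.2 y.1).

Lemma boundary_hermitian : hermitian_form boundary_form.
Proof.
split=> [a x y z|x y]; rewrite /boundary_form.
  by rewrite /= !hb.1; ring.
rewrite (hb.2 y.1) (hb.2 y.2) !rmorphM !rmorphB /= -!hb.2 complexiE conjCi.
by ring.
Qed.

Lemma graph_neutral x : graph x -> boundary_form x x = 0.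
Proof.
by case=> Dx xE; rewrite /boundary_form xE symA // subrr mulr0.
Qed.

(** This is the graph of [A^*], expressed as the orthogonal space of the graph of [A] for the
    boundary form. *)
Definition adjoint_graph (x : H * H) : Prop := forall y, graph y -> boundary_form x y = 0.

Lemma adjoint_graphP x : adjoint_graph x <-> forall g, D g -> ip (A g) x.1 = ip g x.2.
Proof.
split=> [ax g Dg|ax [g h] [/= Dg ->]]; last first.
  by rewrite /boundary_form /= (hb.2 (A g)) (hb.2 g) ax // subrr mulr0.
have := ax (g, A g) (conj Dg erefl); rewrite /boundary_form /=.
move/eqP; rewrite mulf_eq0 (negPf complexi_neq0) /= subr_eq0 => /eqP e.
by rewrite (hb.2 x.1) e -hb.2.
Qed.

(** Modulo the graph of [A], the graph of [A^*] is spanned by the pairs [(w, i w)] and [(u, - i u)]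
    with [w] and [u] in the two deficiency spaces. *)
Lemma adjoint_graph_finite : finite_deficiency ip D A ->
  exists d, ~ indep graph adjoint_graph d.
Proof.
case=> [[s1 s1P] [s2 s2P]].
pose s (j : 'I_(size s1) + 'I_(size s2)) : H * H := match j with
  | inl k => (s1`_k, 'i%C *: s1`_k) | inr k => (s2`_k, - ('i%C *: s2`_k)) end.
exists #|{: 'I_(size s1) + 'I_(size s2)}|.+1.
apply: (@span_dep R[i] (H * H)%type _ graph adjoint_graph s); first exact: graph_subspace.
move=> [f h] /adjoint_graphP /= fh.
have [g [w [Dg dw kE]]] := range_decomposition (h + 'i%C *: f).
(* On the kernel of [A^* - i] the operator [A^* + i] is multiplication by [2i]. Hence [A^* + i]
   sends [w'] to [w] and kills [u = f - g - w']. *)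
pose w' := (2 * 'i%C)^-1 *: w; pose u := f - g - w'.
have i2 : 2 * 'i%C != 0 :> R[i] by rewrite mulf_neq0 ?pnatr_eq0 ?complexi_neq0.
have wE : w = 'i%C *: w' + 'i%C *: w'.
  have i2E : 'i%C + 'i%C = 2 * 'i%C :> R[i] by ring.
  by rewrite -scalerDl scalerA i2E mulfV // scale1r.
have hE : h = A g + 'i%C *: w' - 'i%C *: u.
  rewrite -[LHS](addrK ('i%C *: f)) kE wE /u !scalerBr !opprD !opprK.
  by rewrite [LHS](AC (2*2*1) (1*3*(5*2*4))).
have dw' : deficiency_space ip D A 'i%C w'.
  move=> z Dz; rewrite (hformZr ip) // dw // !ipiZr (hformZr ip) //; ring.
have du : deficiency_space ip D A (- 'i) u.
  move=> z Dz; have -> : - 'i *: u = h - A g - 'i%C *: w'.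
    rewrite hE complexiE scaleNr.
    by rewrite [RHS](ACl ((1*4)*((2*5)*3))) /= !subrr !add0r.
  rewrite /u !(hformBr ip) // fh // dw' // symA //.
have [c1 c1E] := s1P _ dw'; have [c2 c2E] := s2P _ du.
pose c (j : 'I_(size s1) + 'I_(size s2)) : R[i] :=
  match j with inl k => c1`_k | inr k => c2`_k end.
exists c; have -> : (f, h) - \sum_j c j *: s j = (g, A g); last by [].
have sumE : \sum_j c j *: s j = (w' + u, 'i%C *: w' - 'i%C *: u).
  rewrite big_sumType /=.
  rewrite !pair_sum; congr pair => /=; first by rewrite c1E c2E.
  rewrite {1}c1E {1}c2E !scaler_sumr -sumrN; congr (_ + _); apply: eq_bigr => k _ /=.
    by rewrite !scalerA mulrC.
  by rewrite scalerN !scalerA mulrC.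
have -> : f = g + (w' + u) by rewrite /u -addrA -opprD addrA addrC subrK.
by rewrite sumE hE -addrA; congr pair; rewrite /= addrK.
Qed.
End Symmetric.
End Operators.

(** * The affine group *)

Section AffineSubgroups.
Context {R : realType}.
Implicit Types g h : R * R.

Lemma aff_compA g h k : aff_comp g (aff_comp h k) = aff_comp (aff_comp g h) k.
Proof. by rewrite /aff_comp /=; congr pair; ring. Qed.

Lemma aff_comp1 g : aff_comp g (@aff_id R) = g.
Proof. by case: g => a b; rewrite /aff_comp /=; congr pair; ring. Qed.

Lemma aff_1comp g : aff_comp (@aff_id R) g = g.
Proof. by case: g => a b; rewrite /aff_comp /=; congr pair; ring. Qed.

Lemma aff_compV g : in_aff g -> aff_comp g (aff_inv g) = @aff_id R.
Proof.
case: g => a b; rewrite /in_aff /= => a0; rewrite /aff_comp /aff_inv /aff_id /=.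
by congr pair; field; rewrite gt_eqF.
Qed.

Lemma aff_Vcomp g : in_aff g -> aff_comp (aff_inv g) g = @aff_id R.
Proof.
case: g => a b; rewrite /in_aff /= => a0; rewrite /aff_comp /aff_inv /aff_id /=.
by congr pair; field; rewrite gt_eqF.
Qed.

Lemma in_aff_inv g : in_aff g -> in_aff (aff_inv g).
Proof. by rewrite /in_aff /= invr_gt0. Qed.

Lemma in_aff_comp g h : in_aff g -> in_aff h -> in_aff (aff_comp g h).
Proof. exact: mulr_gt0. Qed.

Lemma aff_inv_unique g h : in_aff g -> aff_comp h g = @aff_id R -> h = aff_inv g.
Proof.
by move=> g0 hg; rewrite -[h]aff_comp1 -(aff_compV _ g0) aff_compA hg aff_1comp.
Qed.

Lemma aff_invK g : in_aff g -> aff_inv (aff_inv g) = g.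
Proof.
by move=> g0; apply/esym/aff_inv_unique; [exact: in_aff_inv|exact: aff_compV].
Qed.

Lemma aff_iter_comm g h m : aff_comp g h = aff_comp h g ->
  aff_comp g (iter m (aff_comp h) (@aff_id R)) =
  aff_comp (iter m (aff_comp h) (@aff_id R)) g.
Proof.
move=> gh; elim: m => [|m IHm] /=; first by rewrite aff_comp1 aff_1comp.
by rewrite aff_compA gh -aff_compA IHm aff_compA.
Qed.

Lemma in_aff_iter g m : in_aff g -> in_aff (iter m (aff_comp g) (@aff_id R)).
Proof.
by move=> g0; elim: m => [|m IHm]; [exact: ltr01|exact: in_aff_comp].
Qed.

Lemma aff_inv_iter g m : in_aff g ->
  aff_inv (iter m (aff_comp g) (@aff_id R)) = iter m (aff_comp (aff_inv g)) (@aff_id R).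
Proof.
move=> g0; apply/esym/aff_inv_unique; first exact: in_aff_iter.
elim: m => [|m IHm] /=; first exact: aff_comp1.
rewrite (aff_iter_comm g g) // -aff_compA [aff_comp _ (aff_comp _ g)]aff_compA.
by rewrite IHm aff_1comp aff_Vcomp.
Qed.

Lemma aff_pow_iter g n : in_aff g -> exists h m,
  (h = g \/ h = aff_inv g) /\ aff_pow g n = iter m (aff_comp h) (@aff_id R).
Proof.
move=> g0; case: n => m; first by exists g, m; split=> //; left.
by exists (aff_inv g), m.+1; split=> //; right.
Qed.

(** Every power is an iterate of [g] or of its inverse, and these two commute. *)
Lemma aff_pow_comm g m n : in_aff g ->
  aff_comp (aff_pow g m) (aff_pow g n) = aff_comp (aff_pow g n) (aff_pow g m).
Proof.
move=> g0; have [h [p [hP ->]]] := aff_pow_iter g m g0.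
have [k [q [kP ->]]] := aff_pow_iter g n g0.
apply/aff_iter_comm/esym/aff_iter_comm.
by case: hP => ->; case: kP => -> //; rewrite aff_compV // aff_Vcomp.
Qed.

Lemma aff_inv_pow g n : in_aff g -> exists m, aff_inv (aff_pow g n) = aff_pow g m.
Proof.
move=> g0; case: n => [[|m]|m] /=.
- by exists 0; apply/esym/aff_inv_unique; [exact: ltr01|exact: aff_comp1].
(* [Negz m] stands for the exponent [-(m+1)], so it pairs with [Posz m.+1]. *)
- by exists (Negz m); apply: (aff_inv_iter g m.+1).
- exists (Posz m.+1); rewrite -[in RHS](aff_invK g) //.
  by apply: (aff_inv_iter _ m.+1); apply: in_aff_inv.
Qed.

Lemma one_parameter_id (phi : R -> R * R) : one_parameter phi -> phi 0 = @aff_id R.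
Proof.
case=> pos hom _; have := hom 0 0; rewrite addr0 => e.
by rewrite -[LHS]aff_1comp -(aff_Vcomp _ (pos 0)) -aff_compA -e.
Qed.

(** Common ground of the cyclic and one-parameter cases: inverses make the maps of graphs
    invertible, and commutativity makes them commute. *)
Definition abelian_affine (G : R * R -> Prop) :=
  [/\ forall g, G g -> in_aff g, forall g, G g -> G (aff_inv g) &
      forall g h, G g -> G h -> aff_comp g h = aff_comp h g].

Lemma cyclic_abelian_affine (G : R * R -> Prop) :
  cyclic_aff_subgroup G -> abelian_affine G.
Proof.
case=> g [g0 GP]; split=> [h /GP [n ->]|h /GP [n ->]|h k /GP [m ->] /GP [n ->]].
- have [h' [m [hP ->]]] := aff_pow_iter g n g0; apply: in_aff_iter.
  by case: hP => -> //; apply: in_aff_inv.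
- by apply/GP; apply: aff_inv_pow.
- exact: aff_pow_comm.
Qed.

Lemma one_parameter_abelian_affine (G : R * R -> Prop) phi : one_parameter phi ->
  (forall g, G g <-> exists t, g = phi t) -> abelian_affine G.
Proof.
move=> hphi GP; have phi0 := one_parameter_id phi hphi; case: hphi => pos hom _.
split=> [g /GP [t ->] //|g /GP [t ->]|g h /GP [s ->] /GP [t ->]].
- apply/GP; exists (- t); apply/esym/aff_inv_unique => //.
  by rewrite -hom addNr.
- by rewrite -!hom addrC.
Qed.
End AffineSubgroups.

(** * Invariant extensions *)

Section Extension.
Context {R : realType} {H : lmodType R[i]} (ip : H -> H -> R[i]).
Hypothesis hH : is_hilbert ip.
Let hb := hilbert_hermitian _ hH.

(* U_g B U_g^-1 = a B + b on Dom B, g = (a, b), says that this map preserves the graph of B *)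
Definition graph_action (U : R * R -> H -> H) (g : R * R) (x : H * H) : H * H :=
  (U g x.1, (g.1^-1)%:C *: (U g x.2 - g.2%:C *: U g x.1)).

Variables (G : R * R -> Prop) (U : R * R -> H -> H).
Hypotheses (hU : unitary_rep ip G U) (hG : abelian_affine G).

Lemma rep_linear g : G g -> linear_map (U g).
Proof. by case: hU => + _ _ => /(_ g) + Gg => /(_ Gg) []. Qed.

Lemma rep_comp g h f : G g -> G h -> U (aff_comp g h) f = U g (U h f).
Proof. by case: hU => _ + _ => + Gg Gh => /(_ g h Gg Gh). Qed.

Lemma rep_invr g f : G g -> U g (U (aff_inv g) f) = f.
Proof.
move=> Gg; case: hG => pos inv _; have [_ _ U1] := hU.
by rewrite -rep_comp ?aff_compV ?U1 //; [exact: pos|exact: inv].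
Qed.

Lemma rep_invl g f : G g -> U (aff_inv g) (U g f) = f.
Proof.
move=> Gg; case: hG => pos inv _; have [_ _ U1] := hU.
by rewrite -rep_comp ?aff_Vcomp ?U1 //; [exact: pos|exact: inv].
Qed.

Lemma graph_action_linear g : G g -> linear_map (graph_action U g).
Proof.
move=> Gg a x y; have lU := rep_linear g Gg.
rewrite /graph_action /= !lU; congr pair.
rewrite /= scalerA [a * _]mulrC -scalerA -scalerDr; congr (_ *: _).
by rewrite scalerBr scalerDr !scalerA [a * _]mulrC opprD addrACA.
Qed.

Lemma graph_action_comm g h x : G g -> G h ->
  graph_action U g (graph_action U h x) = graph_action U h (graph_action U g x).
Proof.
move=> Gg Gh; case: hG => pos _ comm.
have lg := rep_linear g Gg; have lh := rep_linear h Gh.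
have gh := comm g h Gg Gh.
have Ugh f : U g (U h f) = U h (U g f) by rewrite -!rep_comp // gh.
(* Equality of the translation parts of [gh] and [hg] is what matches the coefficients of
   [U g (U h x.1)] in the second components. *)
case: gh => _ b_eq.
have g0 : g.1 != 0 by rewrite gt_eqF // pos.
have h0 : h.1 != 0 by rewrite gt_eqF // pos.
rewrite /graph_action /= Ugh; congr pair; rewrite /=.
rewrite !(linear_mapZ _ _ _ lg, linear_mapZ _ _ _ lh).
rewrite !(linear_mapB _ _ _ lg, linear_mapB _ _ _ lh).
rewrite !(linear_mapZ _ _ _ lg, linear_mapZ _ _ _ lh).
rewrite !Ugh !scalerBr !scalerA -!addrA -!opprD -!scalerDl.
congr (_ *: _ - _ *: _); rewrite -?rmorphM -?rmorphD /=; congr (_%:C).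
  by rewrite mulrC.
transitivity ((h.1 * g.2 + h.2) / (g.1 * h.1)).
  by field; rewrite g0 h0.
by rewrite -b_eq; field; rewrite g0 h0.
Qed.

Lemma graph_actionK g x : G g -> graph_action U g (graph_action U (aff_inv g) x) = x.
Proof.
move=> Gg; case: hG => pos _ _; have g0 : g.1 != 0 by rewrite gt_eqF // pos.
have lg := rep_linear g Gg.
rewrite [RHS]surjective_pairing /graph_action /= rep_invr //; congr pair; rewrite /=.
rewrite (linear_mapZ _ _ _ lg) (linear_mapB _ _ _ lg) (linear_mapZ _ _ _ lg) !rep_invr //.
rewrite invrK scalerBr scalerA -addrA -opprD -scalerDl -rmorphM -rmorphD /=.
have -> : g.1 * - (g.2 / g.1) + g.2 = 0 by field.
by rewrite scale0r subr0 scalerA -rmorphM /= mulVf // scale1r.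
Qed.

(** As [U g] is isometric and [g.2] real, the terms containing [g.2] cancel and only the factor
    [g.1^-1] remains. *)
Lemma boundary_form_action g x y : G g ->
  boundary_form ip (graph_action U g x) (graph_action U g y) =
  (g.1^-1)%:C * boundary_form ip x y.
Proof.
move=> Gg; have isoU u v : ip (U g u) (U g v) = ip u v.
  by case: hU => + _ _ => /(_ g Gg) [].
rewrite /boundary_form /= (hformZr ip) // (hformZl ip) // (hformBr ip) // (hformBl ip) //.
rewrite (hformZr ip) // (hformZl ip) // !isoU.
have conjr (r : R) : ((r%:C)^*)%R = r%:C by apply: conjc_real.
by rewrite !conjr; ring.
Qed.

(** The invariance relation is applied at [U g x.1] and solved for [A (U g x.1)]. *)
Lemma graph_action_graph D A g x : G g -> G_invariant G U D A ->
  graph D A x -> graph D A (graph_action U g x).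
Proof.
move=> Gg /(_ g Gg) [UD _ UA] [Dx xE]; case: hG => pos _ _.
have g0 : g.1 != 0 by rewrite gt_eqF // pos.
split; rewrite /= ?xE; first exact: UD.
have := UA _ (UD _ Dx); rewrite rep_invl // => ->.
by rewrite addrK scalerA -rmorphM /= mulVf // scale1r.
Qed.

(** * Operators defined by nonnegative subspaces *)

Section MaximalGraph.
Variables (D : H -> Prop) (A : H -> H) (W : H * H -> Prop).
Hypothesis dD : densely_defined ip D.
Hypotheses (symA : symmetric_op ip D A) (sW : subspace W).
Hypotheses (AW : forall x, graph D A x -> W x) (pW : nonneg_on (boundary_form ip) W).

(** The graph of [A] is neutral inside the nonnegative [W], hence orthogonal to [(0, h - h')]. This
    pair therefore lies in the graph of [A^*], which makes [h - h'] orthogonal to the dense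
    domain. *)
Lemma nonneg_graph_functional f h h' : W (f, h) -> W (f, h') -> h = h'.
Proof.
move=> Wh Wh'; apply/eqP; rewrite -subr_eq0; apply/eqP.
apply: (dense_orthogonal _ hH D) => // g Dg.
have W0 : W (0, h - h').
  have -> : (0, h - h') = (f, h) - (f, h') by rewrite -[in LHS](subrr f).
  exact: subspaceB.
have : adjoint_graph ip D A (0, h - h').
  move=> y Gy; apply: (hformC0 (boundary_form ip)); first exact: boundary_hermitian.
  apply: (neutral_orthogonal _ W) => //; first exact: boundary_hermitian.
  - exact: AW.
  - exact: graph_neutral Gy.
move/(adjoint_graphP _ hH) => /(_ g Dg) /= <-.
by rewrite (hform0r ip).
Qed.

Definition op_dom f := exists h, W (f, h).
Definition op_val f : H := if pselect (op_dom f) is left e then projT1 (cid e) else 0.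

Lemma op_valP f : op_dom f -> W (f, op_val f).
Proof. by rewrite /op_val; case: pselect => // e _; case: (cid e). Qed.

Lemma op_valE f h : W (f, h) -> op_val f = h.
Proof. by move=> Wh; apply: (nonneg_graph_functional f) => //; apply: op_valP; exists h. Qed.

Lemma op_is_operator : is_operator op_dom op_val.
Proof.
have lin (a : R[i]) f g : op_dom f -> op_dom g -> W (a *: f + g, a *: op_val f + op_val g).
  by move=> /op_valP Wf /op_valP Wg; apply: (sW.2 a (f, op_val f) (g, op_val g)).
split=> [|a f g df dg|a f g df dg].
- by exists 0; apply: sW.1.
- by exists (a *: op_val f + op_val g); apply: lin.
- by apply: op_valE; apply: lin.
Qed.
End MaximalGraph.

(** Fixes the sign: an operator is dissipative when the boundary form is nonnegative on its
    graph. *)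
Lemma Im_boundary_form (f h : H) :
  boundary_form ip (f, h) (f, h) = (2 * complex.Im (ip h f))%:C.
Proof.
rewrite /boundary_form /= (hb.2 h f); case: (ip h f) => a b /=.
by apply/eqP; rewrite eq_complex /=; apply/andP; split; apply/eqP; ring.
Qed.

Lemma boundary_form_ge0 (f h : H) :
  (0 <= boundary_form ip (f, h) (f, h)) = (0 <= complex.Im (ip h f)).
Proof. by rewrite Im_boundary_form ler0c pmulr_rge0. Qed.

Lemma invariant_maximal_dissipative_extension (D : H -> Prop) (A : H -> H) :
  is_operator D A -> densely_defined ip D -> closed_op ip D A -> symmetric_op ip D A ->
  finite_deficiency ip D A -> G_invariant G U D A ->
  exists (D' : H -> Prop) (A' : H -> H),
    [/\ extends D A D' A', maximal_dissipative ip D' A' & G_invariant G U D' A'].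
Proof.
move=> hA dD closedA symA defA invA; have [posG invG commG] := hG.
have [d nind] := adjoint_graph_finite _ hH _ _ hA symA closedA defA.
pose T (i : {g | G g}) := graph_action U (sval i).
have [|||||||||W [sW AW pW iW maxW]] :=
    @invariant_maximal_nonneg R[i] (H * H)%type _ T (boundary_form ip) (graph D A) d.
- by case=> g Gg; apply: graph_action_linear.
- by case=> g Gg [h Gh] x; apply: graph_action_comm.
- by case=> g Gg; exists (exist _ _ (invG g Gg)) => x; apply: graph_actionK.
- by case=> g Gg; exists (g.1^-1)%:C => x y; apply: boundary_form_action.
- exact: boundary_hermitian.
- exact: graph_subspace.
- by case=> g Gg x; apply: graph_action_graph.
- by move=> x; apply: graph_neutral.
- exact: nind.
have valE := op_valE D A W dD symA sW AW pW.
have actW g x : G g -> W x -> W (graph_action U g x).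
  by move=> Gg; apply: (iW (exist _ g Gg)).
exists (op_dom W), (op_val W); split.
- move=> f Df; have Wf : W (f, A f) by apply: AW.
  by split; [exists (A f)|apply: valE].
- split.
    split; first exact: (op_is_operator D A).
    by move=> f /op_valP /pW; rewrite boundary_form_ge0.
  (* The graph of a dissipative extension is a nonnegative subspace containing [W], not assumed
     invariant, so it is contained in [W]. *)
  move=> D' A' ext [opA' dissA'] f Df'.
  exists (A' f); apply: (maxW (graph D' A')) => //; first exact: graph_subspace.
    by move=> [g h] [/= Dg ->]; rewrite boundary_form_ge0; apply: dissA'.
  move=> [g h] Wgh; have [|D'g A'g] := ext g; first by exists h.
  by split=> //=; rewrite A'g; apply/esym/valE.
move=> g Gg; have g0 : g.1 != 0 by rewrite gt_eqF // posG.
split=> [f [h Wfh]|f [h Wfh]|f df].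
- by exists (graph_action U g (f, h)).2; apply: (actW g (f, h)).
- exists (U (aff_inv g) f); rewrite rep_invr //; split=> //.
  exists (graph_action U (aff_inv g) (f, h)).2.
  by apply: (actW (aff_inv g) (f, h)) => //; apply: invG.
- have Gg' := invG g Gg; have /op_valP Wf' : op_dom W (U (aff_inv g) f).
    exists (graph_action U (aff_inv g) (f, op_val W f)).2.
    by apply: (actW (aff_inv g) (f, _)) => //; apply: op_valP.
  (* Acting by [g] on the pair at [U (aff_inv g) f] gives a pair in [W] over [f]; uniqueness
     identifies its second component with the value at [f]. *)
  have := actW g _ Gg Wf'; rewrite /graph_action /= rep_invr // => /valE ->.
  by rewrite scalerA -rmorphM /= mulfV // scale1r subrK.
Qed.
End Extension.

Theorem theorem5p4 (R : realType) (H : lmodType R[i]) (ip : H -> H -> R[i])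
  (hH : is_hilbert ip) (G : R * R -> Prop) (U : R * R -> H -> H)
  (hU : unitary_rep ip G U)
  (hG : cyclic_aff_subgroup G \/
        exists phi : R -> R * R,
          [/\ one_parameter phi, (forall g, G g <-> exists t, g = phi t) &
              strongly_continuous ip U phi])
  (D : H -> Prop) (A : H -> H)
  (hA : is_operator D A) (hdense : densely_defined ip D) (hclosed : closed_op ip D A)
  (hsym : symmetric_op ip D A) (hdef : finite_deficiency ip D A)
  (hinv : G_invariant G U D A) :
  exists (D' : H -> Prop) (A' : H -> H),
    [/\ extends D A D' A', maximal_dissipative ip D' A' & G_invariant G U D' A'].
Proof.
apply: (invariant_maximal_dissipative_extension _ hH G U hU) => //.
case: hG => [|[phi [hphi GP _]]]; first exact: cyclic_abelian_affine.
exact: one_parameter_abelian_affine hphi GP.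
Qed.
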